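(* Let $F_2=F_2(x,z)$ be a smooth function with $\frac{\partial F_2}{\partial x}\neq 0$ satisfying $$\frac{\partial F_2}{\partial z}=-\frac{\partial^3 F_2}{\partial x^3}+\frac32\,\frac{\left(\frac{\partial^2 F_2}{\partial x^2}\right)^2}{\frac{\partial F_2}{\partial x}}.$$ Put $$F_1(x,z)=-2\,\frac{\partial F_2}{\partial x}(x,z),\qquad l(x,z)=-\frac13\,\frac{\frac{\partial F_2}{\partial z}-2\,\frac{\partial^3 F_2}{\partial x^3}}{\frac{\partial F_2}{\partial x}},$$ $$B(x,y,z)=\tfrac14 F_1(x,z)^2y^2+\tfrac12 F_1(x,z)F_2(x,z)\,y+\tfrac14F_2(x,z)^2 .$$ Then the six-dimensional metric in local coordinates $(x,y,z,u,v,w)$ $$ds^2=y^2dx^2+2\left(y^2l(x,z)-\tfrac12\right)dx\,dz+2\,dy\,dz+\left(y^2l(x,z)^2-2y\,\frac{\partial l}{\partial x}(x,z)+l(x,z)\right)dz^2$$ $$\qquad+\frac{2B(x,y,z)}{(uw+vw+uv)^2}\left(du\,dv+du\,dw+dv\,dw\right),$$ considered on the open set where $y\ne0$, $B(x,y,z)\neq0$ and $uw+vw+uv\neq 0$, is flat.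
   Context: A (pseudo-Riemannian) metric is called flat if its Riemann curvature tensor vanishes identically, $R_{ijkl}=0$. In the line element, $dx\,dz$ etc. denote symmetric products, so that the coefficient of $dx^i\,dx^j$ with $i\neq j$ equals $2g_{ij}$. All functions are smooth functions of real variables on suitable open domains. *)

(* Defs.v *)
From HB Require Import structures.
From mathcomp Require Import all_boot all_order all_algebra ring.
From mathcomp Require Import all_classical all_reals all_analysis.

Set Implicit Arguments.
Unset Strict Implicit.
Unset Printing Implicit Defensive.

Import Order.TTheory GRing.Theory Num.Theory.
Import numFieldNormedType.Exports.

Local Open Scope classical_set_scope.
Local Open Scope ring_scope.

Definition partial (R : realType) (n : nat) (i : 'I_n) (f : 'rV[R]_n -> R) :
    'rV[R]_n -> R :=
  'D_(delta_mx 0 i) f.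

Notation "''d_' i f" := (partial i f)
  (at level 10, i at level 8, f at next level, format "''d_' i  f").

(* C^oo: all iterated partial derivatives exist and are continuous on U.      *)
Definition smooth_on (R : realType) (n : nat) (U : set 'rV[R]_n)
    (f : 'rV[R]_n -> R) : Prop :=
  forall s : seq 'I_n, let h := foldr (@partial R n) f s in
  forall p, U p ->
    {for p, continuous h} /\ forall i, derivable h p (delta_mx 0 i).

Definition pseudo_riemannian_on (R : realType) (n : nat) (U : set 'rV[R]_n)
    (g : 'rV[R]_n -> 'M[R]_n) : Prop :=
  [/\ forall i j, smooth_on U (fun p => g p i j),
      forall p, U p -> (g p)^T = g p &
      forall p, U p -> g p \in unitmx].

(* christoffel g k i j is Gamma^k_(ij) of the Levi-Civita connection.         *)
Definition christoffel (R : realType) (n : nat) (g : 'rV[R]_n -> 'M[R]_n)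
    (k i j : 'I_n) (p : 'rV[R]_n) : R :=
  2^-1 * \sum_m invmx (g p) k m *
    ('d_i (fun q => g q j m) p + 'd_j (fun q => g q i m) p
     - 'd_m (fun q => g q i j) p).

(* riemann_up g m j k l is R^m_(jkl), with the sign convention
   R^m_(jkl) = d_k Gamma^m_(lj) - d_l Gamma^m_(kj) + ...                      *)
Definition riemann_up (R : realType) (n : nat) (g : 'rV[R]_n -> 'M[R]_n)
    (m j k l : 'I_n) (p : 'rV[R]_n) : R :=
  'd_k (christoffel g m l j) p - 'd_l (christoffel g m k j) p
  + \sum_s (christoffel g m k s p * christoffel g s l j p
            - christoffel g m l s p * christoffel g s k j p).

Definition riemann (R : realType) (n : nat) (g : 'rV[R]_n -> 'M[R]_n)
    (i j k l : 'I_n) (p : 'rV[R]_n) : R :=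
  \sum_m g p i m * riemann_up g m j k l p.

Definition flat_on (R : realType) (n : nat) (U : set 'rV[R]_n)
    (g : 'rV[R]_n -> 'M[R]_n) : Prop :=
  [/\ open U, pseudo_riemannian_on U g &
      forall p, U p -> forall i j k l, riemann g i j k l p = 0].

(* Functions of (x, z) are functions on 'rV[R]_2; x and z are its coordinates
   0 and 1. The coordinates of 'rV[R]_6 are (x, y, z, u, v, w), in this order. *)
Notation "''dx' f" := ('d_(0 : 'I_2) f)
  (at level 10, f at next level, format "''dx'  f").
Notation "''dz' f" := ('d_(1 : 'I_2) f)
  (at level 10, f at next level, format "''dz'  f").

Definition F1 (R : realType) (F2 : 'rV[R]_2 -> R) (q : 'rV[R]_2) : R :=
  - 2 * 'dx F2 q.

Definition l (R : realType) (F2 : 'rV[R]_2 -> R) (q : 'rV[R]_2) : R :=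
  - (1 / 3) * (('dz F2 q - 2 * 'dx ('dx ('dx F2)) q) / 'dx F2 q).

Definition B (R : realType) (F2 : 'rV[R]_2 -> R) (q : 'rV[R]_2) (y : R) : R :=
  1 / 4 * F1 F2 q ^+ 2 * y ^+ 2 + 1 / 2 * F1 F2 q * F2 q * y
  + 1 / 4 * F2 q ^+ 2.

Definition xz (R : realType) (p : 'rV[R]_6) : 'rV[R]_2 :=
  \row_(k < 2) (if k == 0 then p 0 0 else p 0 2).

Definition uvw (R : realType) (p : 'rV[R]_6) : R :=
  let u := p 0 3 in let v := p 0 4 in let w := p 0 5 in
  u * w + v * w + u * v.

(* The symmetric matrix (g_ij) of the line element; see line_elementE.        *)
Definition metric (R : realType) (F2 : 'rV[R]_2 -> R) (p : 'rV[R]_6) :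
    'M[R]_6 :=
  let y := p 0 1 in
  let lp := l F2 (xz p) in
  let gxz := y ^+ 2 * lp - 1 / 2 in
  let gzz := y ^+ 2 * lp ^+ 2 - 2 * y * 'dx (l F2) (xz p) + lp in
  let c := B F2 (xz p) y / uvw p ^+ 2 in
  \matrix_(i, j) nth 0 (nth [::]
    [:: [:: y ^+ 2; 0; gxz; 0; 0; 0];
        [:: 0;      0; 1;   0; 0; 0];
        [:: gxz;    1; gzz; 0; 0; 0];
        [:: 0;      0; 0;   0; c; c];
        [:: 0;      0; 0;   c; 0; c];
        [:: 0;      0; 0;   c; c; 0]] i) j.

Lemma line_elementE (R : realType) (F2 : 'rV[R]_2 -> R) (p dp : 'rV[R]_6) :
  let y := p 0 1 in
  let lp := l F2 (xz p) in
  let: (dx, dy, dz) := (dp 0 0, dp 0 1, dp 0 2) in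
  let: (du, dv, dw) := (dp 0 3, dp 0 4, dp 0 5) in
  (dp *m metric F2 p *m dp^T) 0 0 =
    y ^+ 2 * dx ^+ 2 + 2 * (y ^+ 2 * lp - 1 / 2) * dx * dz + 2 * dy * dz
    + (y ^+ 2 * lp ^+ 2 - 2 * y * 'dx (l F2) (xz p) + lp) * dz ^+ 2
    + 2 * B F2 (xz p) y / uvw p ^+ 2 * (du * dv + du * dw + dv * dw).
Proof.
move=> /=.
have E (f : 'I_6 -> R) : \sum_i f i = f 0 + f 1 + f 2 + f 3 + f 4 + f 5.
  rewrite !big_ord_recr big_ord0 /= add0r.
  by do ![congr (_ + _)]; congr f; apply/val_inj.
by rewrite mxE E !mxE !E !mxE /=; ring.
Qed.

Definition metric_domain (R : realType) (U : set 'rV[R]_2)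
    (F2 : 'rV[R]_2 -> R) : set 'rV[R]_6 :=
  [set p | [/\ U (xz p), p 0 1 != 0, B F2 (xz p) (p 0 1) != 0 & uvw p != 0]].

(* Main.v *)
(* The metric is g3 + B h, where h is the pull-back of the flat metric
   2(dX1 dX2 + dX1 dX3 + dX2 dX3) under the inversion X = (u, v, w) / Q,
   Q = uw + vw + uv, and B = f^2 with f = F2 / 2 - (dF2/dx) y. Write
   F' = dF2/dx, a = F'' / F' and s = dx + l dz. The equation for F2 says that
   l = da/dx + a^2 / 2 and dF2/dz = - F' (l - a^2), which makes f a null
   function:
     g3 = (y s - a dz)^2 - 2 df dz / F'.
   One gets, for the coframe
     e0 = df, e1 = y s - a dz, e2 = - dz / F' - d(f / Q), e3..e5 = d(f X),
   that the metric is e1^2 + 2 e0 e2 + 2 (e3 e4 + e3 e5 + e4 e5). Its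
   Levi-Civita connection form in this coframe is theta N, where N is a constant
   nilpotent matrix and theta = - s / F' is closed; hence the curvature
   d(theta) N + theta /\ theta N^2 vanishes. *)
Require Import Defs.
From HB Require Import structures.
From mathcomp Require Import all_boot all_order all_algebra.
From mathcomp Require Import all_classical all_reals all_analysis.
From mathcomp Require Import ring.

Set Implicit Arguments.
Unset Strict Implicit.
Unset Printing Implicit Defensive.

Import Order.TTheory GRing.Theory Num.Theory.
Import numFieldNormedType.Exports.

Local Open Scope classical_set_scope.
Local Open Scope ring_scope.

(** * Differentiation rules for directional derivatives of scalar functions *)

Section DirectionalDerivative.
Variables (R : realType) (V : normedModType R).
Implicit Types (f g : V -> R) (p v : V).

Lemma is_derive_add f g p v a b : is_derive p v f a -> is_derive p v g b ->
  is_derive p v (fun q => f q + g q) (a + b).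
Proof. by move=> fa gb; exact: (is_deriveD fa gb). Qed.

Lemma is_derive_opp f p v a : is_derive p v f a ->
  is_derive p v (fun q => - f q) (- a).
Proof. by move=> fa; exact: (is_deriveN fa). Qed.

Lemma is_derive_mul f g p v a b : is_derive p v f a -> is_derive p v g b ->
  is_derive p v (fun q => f q * g q) (a * g p + f p * b).
Proof.
by move=> fa gb; apply: is_derive_eq (is_deriveM fa gb) _; rewrite addrC mulrC.
Qed.

Lemma is_derive_inv f p v a : f p != 0 -> is_derive p v f a ->
  is_derive p v (fun q => (f q)^-1) (- a / f p ^+ 2).
Proof.
move=> f0 [df fa]; apply: DeriveDef; first exact: derivableV.
by rewrite deriveV// fa /GRing.scale/= mulNr mulrC mulNr.
Qed.

Lemma is_derive_sum_fun n (f : 'I_n -> V -> R) p v (a : 'I_n -> R) :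
  (forall i, is_derive p v (f i) (a i)) ->
  is_derive p v (fun q => \sum_i f i q) (\sum_i a i).
Proof.
move=> fa; have := is_derive_sum fa.
by congr is_derive; apply/funext => q; rewrite fct_sumE.
Qed.

End DirectionalDerivative.

(** * Schwarz's theorem on mixed second derivatives *)

Section SymmetricDerivatives.
Variables (R : realType) (V : normedModType R).
Implicit Types (f : V -> R) (p q v w : V).

(** Restriction to a line, so that the one-variable [MVT] applies: the two difference quotients are
    the same function of [h]. *)
Lemma is_derive_line f q v (r : R) : derivable f (q + r *: v) v ->
  is_derive r 1 (fun s : R => f (q + s *: v)) ('D_v f (q + r *: v)).
Proof.
have E : (fun h : R => h^-1 *: (((fun s : R => f (q + s *: v)) \o shift r) (h *: 1)
    - f (q + r *: v))) =
    (fun h : R => h^-1 *: ((f \o shift (q + r *: v)) (h *: v) - f (q + r *: v))).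
  apply/funext => h /=; congr (_ *: (f _ - _)).
  by rewrite /GRing.scale/= mulr1 -/(GRing.scale _ _) scalerDl addrCA.
by move=> df; split; rewrite /derivable /derive E.
Qed.

(* The mean value theorem, applied in the direction v and then in the
   direction w. *)
Lemma second_difference f p v w (t : R) : 0 < t ->
  (forall r s, 0 <= r <= t -> 0 <= s <= t ->
    derivable f (p + r *: v + s *: w) v /\
    derivable ('D_v f) (p + r *: v + s *: w) w) ->
  exists r s, [/\ 0 <= r <= t, 0 <= s <= t &
    f (p + t *: v + t *: w) - f (p + t *: v) - f (p + t *: w) + f p =
      'D_w ('D_v f) (p + r *: v + s *: w) * t * t].
Proof.
move=> t0 df.
have tt : 0 <= t <= t by rewrite lexx (ltW t0).
have zt : (0 : R) <= 0 <= t by rewrite lexx (ltW t0).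
have bnd (r : R) : r \in `]0, t[ -> 0 <= r <= t.
  by rewrite in_itv/= => /andP[/ltW -> /ltW ->].
have cont (g dg : R -> R) : (forall r, 0 <= r <= t -> is_derive r 1 g (dg r)) ->
    {within `[0, t], continuous g}.
  move=> dgE; apply: derivable_within_continuous => r; rewrite in_itv/= => rt.
  by have [] := dgE r rt.
(* [phi] is the increment along [t *: w] seen from [p + r *: v]; the second difference is
   [phi t - phi 0]. *)
pose phi (r : R) := f (p + t *: w + r *: v) - f (p + r *: v).
pose dphi (r : R) := 'D_v f (p + t *: w + r *: v) - 'D_v f (p + r *: v).
have dphiE r : 0 <= r <= t -> is_derive r 1 phi (dphi r).
  move=> rt; rewrite /phi /dphi; apply: is_derive_add; first last.
    apply: is_derive_opp; apply: is_derive_line.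
    by have [] := df r 0 rt zt; rewrite scale0r addr0.
  apply: is_derive_line; have [] := df r t rt tt.
  by rewrite [_ + t *: w]addrAC.
have [r /bnd rt phiE] := MVT t0 (fun r rt => dphiE r (bnd r rt)) (cont _ _ dphiE).
(* The value [dphi r] is itself an increment, that of ['D_v f] along [t *: w], which the second use
   of [MVT] evaluates. *)
pose psi (s : R) := 'D_v f (p + r *: v + s *: w).
pose dpsi (s : R) := 'D_w ('D_v f) (p + r *: v + s *: w).
have dpsiE s : 0 <= s <= t -> is_derive s 1 psi (dpsi s).
  by move=> st; apply: is_derive_line; have [] := df r s rt st.
have [s /bnd st psiE] := MVT t0 (fun s st => dpsiE s (bnd s st)) (cont _ _ dpsiE).
exists r, s; split => //.
have -> : f (p + t *: v + t *: w) - f (p + t *: v) - f (p + t *: w) + f p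
    = phi t - phi 0.
  by rewrite /phi !scale0r !addr0 [p + t *: w + _]addrAC; ring.
rewrite phiE subr0; congr (_ * _).
have -> : dphi r = psi t - psi 0.
  by rewrite /dphi /psi scale0r addr0 [p + t *: w + _]addrAC.
by rewrite psiE subr0.
Qed.

(** One and the same second difference, read in the two orders, equals [t ^+ 2] times either mixed
    derivative at points close to [p]. By continuity at [p] the two values there cannot differ. *)
Lemma derive_comm f p v w :
  (\forall q \near p, [/\ derivable f q v, derivable f q w,
     derivable ('D_v f) q w & derivable ('D_w f) q v]) ->
  {for p, continuous ('D_w ('D_v f))} ->
  {for p, continuous ('D_v ('D_w f))} ->
  'D_w ('D_v f) p = 'D_v ('D_w f) p.
Proof.
move=> df cwv cvw; apply/eqP; apply: contraT => neq.
(* Half the supposed gap: no number lies within [e] of both values. *)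
set e := `|'D_w ('D_v f) p - 'D_v ('D_w f) p| / 2.
have e0 : 0 < e by rewrite divr_gt0// normr_gt0 subr_eq0.
have nwv : \forall q \near p, `|'D_w ('D_v f) p - 'D_w ('D_v f) q| < e.
  by move/cvgrPdist_lt: cwv => /(_ _ e0).
have nvw : \forall q \near p, `|'D_v ('D_w f) p - 'D_v ('D_w f) q| < e.
  by move/cvgrPdist_lt: cvw => /(_ _ e0).
have [d /= d0 dP] := (nbhs_ballP _ _).1 (filterI df (filterI nwv nvw)).
have vw0 : 0 < `|v| + `|w| + 1 by rewrite ltr_wpDl ?addr_ge0.
(* The extra summand [t] keeps the divisor positive when [v] and [w] vanish and makes the bound on
   the parallelogram strict. *)
have [t t0 tE] : exists2 t : R, 0 < t & t * `|v| + t * `|w| + t = d / 2.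
  exists (d / 2 / (`|v| + `|w| + 1)); first by rewrite !divr_gt0.
  by rewrite -[X in _ + X]mulr1 -!mulrDr divfK// gt_eqF.
have inb (r s : R) : 0 <= r <= t -> 0 <= s <= t -> ball p d (p + r *: v + s *: w).
  move=> /andP[r0 rt] /andP[s0 st].
  rewrite -ball_normE/= distrC -[p + _ + _]addrA [_ - p]addrC addKr.
  rewrite (le_lt_trans (ler_normD _ _))// !normrZ !ger0_norm//.
  have h1 := ler_wpM2r (normr_ge0 v) rt; have h2 := ler_wpM2r (normr_ge0 w) st.
  rewrite (le_lt_trans (lerD h1 h2))// (@lt_trans _ _ (d / 2))//.
    by rewrite -tE ltrDl.
  by rewrite ltr_pdivrMr// ltr_pMr// ltr1n.
have [r [s [rt st E1]]] : exists r s, [/\ 0 <= r <= t, 0 <= s <= t &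
    f (p + t *: v + t *: w) - f (p + t *: v) - f (p + t *: w) + f p =
      'D_w ('D_v f) (p + r *: v + s *: w) * t * t].
  apply: second_difference t0 _ => r s rt st.
  by have [[dv _ dwv _] _] := dP _ (inb r s rt st); split; [exact: dv|exact: dwv].
have [r' [s' [rt' st' E2]]] : exists r s, [/\ 0 <= r <= t, 0 <= s <= t &
    f (p + t *: w + t *: v) - f (p + t *: w) - f (p + t *: v) + f p =
      'D_v ('D_w f) (p + r *: w + s *: v) * t * t].
  apply: second_difference t0 _ => a b at' bt; rewrite [_ + a *: w + _]addrAC.
  by have [[_ dw _ dvw] _] := dP _ (inb b a bt at'); split; [exact: dw|exact: dvw].
have cancel (x y z z' : R) : z = x * t * t -> z' = y * t * t -> z = z' -> x = y.
  move=> -> -> /mulIf xy; apply: (mulIf _ (xy _)); exact: lt0r_neq0.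
have swap : f (p + t *: v + t *: w) - f (p + t *: v) - f (p + t *: w) + f p =
    f (p + t *: w + t *: v) - f (p + t *: w) - f (p + t *: v) + f p.
  by rewrite [p + t *: v + t *: w]addrAC; congr (_ + _); exact: addrAC.
have E := cancel _ _ _ _ E1 E2 swap.
have far (a b c : R) : `|a - c| < `|a - b| / 2 -> `|b - c| < `|a - b| / 2 -> false.
  move=> ac bc; have := ler_normD (a - c) (c - b).
  rewrite addrA subrK [`|c - b|]distrC.
  by move=> /le_lt_trans/(_ (ltrD ac bc)); rewrite -splitr ltxx.
have [_ [h1 _]] := dP _ (inb r s rt st).
have [_ [_ h2]] := dP _ (inb s' r' st' rt').
apply: far h1 _; rewrite E.
have <- : p + s' *: v + r' *: w = p + r' *: w + s' *: v by exact: addrAC.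
exact: h2.
Qed.

End SymmetricDerivatives.

Lemma is_derive_coord (R : realType) n (i : 'I_n) (p v : 'rV[R]_n) :
  is_derive p v (fun q => q 0 i) (v 0 i).
Proof.
have c : (fun h : R => h^-1 *: (((fun q : 'rV[R]_n => q 0 i) \o shift p) (h *: v)
    - p 0 i)) @ 0^' --> v 0 i.
  (* The difference quotient is constant for [h] nonzero. *)
  apply: cvg_near_cst; near=> h; rewrite /= !mxE addrK.
  by rewrite /GRing.scale/= mulKf//; near: h; exact: nbhs_dnbhs_neq.
by split; [apply/cvg_ex; exists (v 0 i)|exact: cvg_lim c].
Unshelve. all: by end_near. Qed.

(** * Smooth functions on an open set: coinduction and closure properties *)

Section Smooth.
Variables (R : realType) (n : nat) (U : set 'rV[R]_n).
Hypothesis openU : open U.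
Implicit Types f g : 'rV[R]_n -> R.

Definition regular_on f := forall p, U p ->
  {for p, continuous f} /\ forall i, derivable f p (delta_mx 0 i).

Lemma smooth_onP f :
  smooth_on U f <-> regular_on f /\ forall i, smooth_on U ('d_i f).
Proof.
split=> [sf|[rf sf] s h p Up].
  split=> [|i s h p Up]; first exact: (sf [::]).
  by rewrite /h -[foldr _ _ _]/(foldr _ (foldr (@partial R n) f [:: i]) s)
    -foldr_cat; exact: sf.
(* [foldr] applies the last index of [s] first, so the innermost derivative is split off at the
   right end. *)
rewrite {}/h; elim/last_ind: s => [|s i _]; first exact: rf.
by rewrite -cats1 foldr_cat; exact: sf.
Qed.

(** Smoothness is the largest class of regular functions stable under all ['d_i]. *)
Lemma smooth_on_coind (P : ('rV[R]_n -> R) -> Prop) :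
  (forall f, P f -> regular_on f /\ forall i, P ('d_i f)) ->
  forall f, P f -> smooth_on U f.
Proof.
move=> PP f Pf s; suff: P (foldr (@partial R n) f s) by case/PP.
by elim: s => //= i s /PP[].
Qed.

(* Coinduction needs a class stable under 'd_i: derivatives of products and
   inverses are not single products or inverses, hence this closure. *)
Inductive smooth_algebra : ('rV[R]_n -> R) -> Prop :=
| SA_atom f : smooth_on U f -> smooth_algebra f
| SA_add f g : smooth_algebra f -> smooth_algebra g ->
    smooth_algebra (fun p => f p + g p)
| SA_mul f g : smooth_algebra f -> smooth_algebra g ->
    smooth_algebra (fun p => f p * g p)
| SA_inv f : smooth_algebra f -> (forall p, U p -> f p != 0) ->
    smooth_algebra (fun p => (f p)^-1)
| SA_eq f g : smooth_algebra f -> (forall p, U p -> f p = g p) ->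
    smooth_algebra g.

(** Derivatives depend only on germs; openness of [U] turns equality on [U] into equality of
    germs. *)
Lemma near_on f g : (forall p, U p -> f p = g p) ->
  forall p, U p -> \near p, f p = g p.
Proof. by move=> fg p Up; apply: filterS fg _; exact: open_nbhs_nbhs. Qed.

Lemma smooth_on_cst (c : R) : smooth_on U (fun=> c).
Proof.
apply: (@smooth_on_coind (fun f => exists c, f = cst c)); last by exists c.
move=> _ [{}c ->]; split=> [p Up|i].
  by split=> [|i]; [exact: cst_continuous|exact: derivable_cst].
by exists 0; apply/funext => p; exact: derive_cst.
Qed.

Lemma partialE f i p a : is_derive p (delta_mx 0 i) f a -> 'd_i f p = a.
Proof. by case. Qed.

Lemma regular_is_derive f i p : regular_on f -> U p ->
  is_derive p (delta_mx 0 i) f ('d_i f p).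
Proof. by move=> rf Up; apply: derivableP; have [_] := rf p Up. Qed.

(** Induction on the construction of [f]: the sum, product and inverse rules present each partial
    derivative as a member of the class again, and [SA_eq] absorbs that these formulas hold on [U]
    only. *)
Lemma smooth_algebra_regular f : smooth_algebra f ->
  regular_on f /\ forall i, smooth_algebra ('d_i f).
Proof.
elim=> {f} [f|f g sf [rf df] sg [rg dg]|f g sf [rf df] sg [rg dg]|
  f sf [rf df] f0|f g sf [rf df] fg].
- by case/smooth_onP => rf sf; split=> // i; exact: SA_atom.
- have D i p : U p ->
      is_derive p (delta_mx 0 i) (fun p => f p + g p) ('d_i f p + 'd_i g p).
    by move=> Up; apply: is_derive_add; exact: regular_is_derive.
  split=> [p Up|i].
    split=> [|i]; last by case: (D i p Up).
    exact: continuousD (rf p Up).1 (rg p Up).1.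
  by apply: SA_eq (SA_add (df i) (dg i)) _ => p /(D i)/partialE ->.
- have D i p : U p -> is_derive p (delta_mx 0 i) (fun p => f p * g p)
      ('d_i f p * g p + f p * 'd_i g p).
    by move=> Up; apply: is_derive_mul; exact: regular_is_derive.
  split=> [p Up|i].
    split=> [|i]; last by case: (D i p Up).
    exact: continuousM (rf p Up).1 (rg p Up).1.
  apply: SA_eq (SA_add (SA_mul (df i) sg) (SA_mul sf (dg i))) _.
  by move=> p /(D i)/partialE ->.
- have D i p : U p -> is_derive p (delta_mx 0 i) (fun p => (f p)^-1)
      (- 'd_i f p / f p ^+ 2).
    by move=> Up; apply: is_derive_inv; [exact: f0|exact: regular_is_derive].
  split=> [p Up|i].
    split=> [|i]; last by case: (D i p Up).
    exact: continuousV (f0 p Up) (rf p Up).1.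
  apply: SA_eq (SA_mul (SA_mul (SA_atom (smooth_on_cst (-1))) (df i))
    (SA_mul (SA_inv sf f0) (SA_inv sf f0))) _.
  by move=> p Up; rewrite (partialE (D i p Up)) expr2 invfM mulN1r.
- split=> [p Up|i].
    have [cf df'] := rf p Up; have nfg := near_on fg Up; split=> [|i].
      rewrite /prop_for /continuous_at -(fg p Up).
      exact: cvg_trans (near_eq_cvg nfg) cf.
    exact: near_eq_derivable nfg (df' i).
  by apply: SA_eq (df i) _ => p Up; exact: near_eq_derive (near_on fg Up).
Qed.

Lemma smooth_algebraP f : smooth_algebra f <-> smooth_on U f.
Proof.
split; last exact: SA_atom.
by apply: smooth_on_coind => {}f; exact: smooth_algebra_regular.
Qed.

Lemma smooth_on_add f g : smooth_on U f -> smooth_on U g ->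
  smooth_on U (fun p => f p + g p).
Proof. by rewrite -!smooth_algebraP; exact: SA_add. Qed.

Lemma smooth_on_mul f g : smooth_on U f -> smooth_on U g ->
  smooth_on U (fun p => f p * g p).
Proof. by rewrite -!smooth_algebraP; exact: SA_mul. Qed.

Lemma smooth_on_inv f : smooth_on U f -> (forall p, U p -> f p != 0) ->
  smooth_on U (fun p => (f p)^-1).
Proof. by rewrite -!smooth_algebraP; exact: SA_inv. Qed.

Lemma smooth_on_eq f g : (forall p, U p -> f p = g p) -> smooth_on U f ->
  smooth_on U g.
Proof. by rewrite -!smooth_algebraP => fg sf; exact: SA_eq sf fg. Qed.

Lemma smooth_on_opp f : smooth_on U f -> smooth_on U (fun p => - f p).
Proof.
move=> sf; apply: smooth_on_eq (smooth_on_mul (smooth_on_cst (-1)) sf).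
by move=> p _; rewrite mulN1r.
Qed.

Lemma smooth_on_partial f i : smooth_on U f -> smooth_on U ('d_i f).
Proof. by case/smooth_onP. Qed.

Lemma smooth_on_sum (I : Type) (r : seq I) (P : pred I) (f : I -> 'rV[R]_n -> R) :
  (forall i, smooth_on U (f i)) ->
  smooth_on U (fun p => \sum_(i <- r | P i) f i p).
Proof.
move=> sf; elim: r => [|i r IH].
  by apply: smooth_on_eq (smooth_on_cst 0) => p _; rewrite big_nil.
have [Pi|Pi] := boolP (P i).
  by apply: smooth_on_eq (smooth_on_add (sf i) IH) => p _; rewrite big_cons Pi.
by apply: smooth_on_eq IH => p _; rewrite big_cons (negPf Pi).
Qed.

Lemma smooth_on_prod (I : Type) (r : seq I) (P : pred I) (f : I -> 'rV[R]_n -> R) :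
  (forall i, smooth_on U (f i)) ->
  smooth_on U (fun p => \prod_(i <- r | P i) f i p).
Proof.
move=> sf; elim: r => [|i r IH].
  by apply: smooth_on_eq (smooth_on_cst 1) => p _; rewrite big_nil.
have [Pi|Pi] := boolP (P i).
  by apply: smooth_on_eq (smooth_on_mul (sf i) IH) => p _; rewrite big_cons Pi.
by apply: smooth_on_eq IH => p _; rewrite big_cons (negPf Pi).
Qed.

Lemma smooth_on_det m (A : 'rV[R]_n -> 'M[R]_m) :
  (forall i j, smooth_on U (fun p => A p i j)) ->
  smooth_on U (fun p => \det (A p)).
Proof.
move=> sA; apply: smooth_on_sum => s.
by apply: smooth_on_mul; [exact: smooth_on_cst|exact: smooth_on_prod].
Qed.

Lemma smooth_on_invmx m (A : 'rV[R]_n -> 'M[R]_m) :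
  (forall i j, smooth_on U (fun p => A p i j)) ->
  (forall p, U p -> A p \in unitmx) ->
  forall i j, smooth_on U (fun p => invmx (A p) i j).
Proof.
move=> sA uA i j.
(* Cramer's rule: the inverse is the adjugate divided by the determinant. *)
have sC : smooth_on U (fun p => cofactor (A p) j i).
  apply: smooth_on_mul; first exact: smooth_on_cst.
  apply: smooth_on_det => k l; apply: smooth_on_eq (sA (lift j k) (lift i l)).
  by move=> p _; rewrite !mxE.
have sD : smooth_on U (fun p => (\det (A p))^-1).
  apply: smooth_on_inv; first exact: smooth_on_det.
  by move=> p /uA; rewrite unitmxE unitfE.
apply: smooth_on_eq (smooth_on_mul sD sC) => p Up.
by rewrite /invmx uA// !mxE.
Qed.

Lemma smooth_on_coord (i : 'I_n) : smooth_on U (fun p => p 0 i).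
Proof.
apply/smooth_onP; split=> [p Up|j].
  split=> [|j]; last by case: (is_derive_coord i p (delta_mx 0 j)).
  exact: coord_continuous.
apply: smooth_on_eq (smooth_on_cst (delta_mx 0 j 0 i)) => p _.
by rewrite (partialE (is_derive_coord i p (delta_mx 0 j))).
Qed.

Lemma smooth_on_is_derive f i p : smooth_on U f -> U p ->
  is_derive p (delta_mx 0 i) f ('d_i f p).
Proof. by case/smooth_onP => rf _ Up; exact: regular_is_derive. Qed.

Lemma smooth_on_continuous f p : smooth_on U f -> U p -> {for p, continuous f}.
Proof. by move=> sf; case/(sf [::]). Qed.

Lemma smooth_on_comm f i j p : smooth_on U f -> U p ->
  'd_i ('d_j f) p = 'd_j ('d_i f) p.
Proof.
move=> sf Up; have s k := smooth_on_partial k sf.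
have ss k m := smooth_on_partial k (s m).
apply: derive_comm.
- apply: filterS (open_nbhs_nbhs (conj openU Up)) => q Uq.
  have D h k : smooth_on U h -> derivable h q (delta_mx 0 k).
    by move=> sh; case: (smooth_on_is_derive k sh Uq).
  by split; [exact: D sf|exact: D sf|exact: D (s j)|exact: D (s i)].
- exact: smooth_on_continuous (ss i j) Up.
- exact: smooth_on_continuous (ss j i) Up.
Qed.

End Smooth.

(** * Entrywise calculus of matrix-valued functions *)

Definition partial_mx (R : realType) n m k (i : 'I_n)
    (A : 'rV[R]_n -> 'M[R]_(m, k)) (p : 'rV[R]_n) : 'M[R]_(m, k) :=
  \matrix_(a, b) 'd_i (fun q => A q a b) p.

Definition smooth_mx_on (R : realType) n m k (U : set 'rV[R]_n)
    (A : 'rV[R]_n -> 'M[R]_(m, k)) : Prop :=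
  forall a b, smooth_on U (fun q => A q a b).

Section MatrixCalculus.
Variables (R : realType) (n : nat) (U : set 'rV[R]_n).
Hypothesis openU : open U.

Lemma partial_mx_eq m k (A B : 'rV[R]_n -> 'M[R]_(m, k)) i p :
  (forall q, U q -> A q = B q) -> U p -> partial_mx i A p = partial_mx i B p.
Proof.
move=> AB Up; apply/matrixP => a b; rewrite !mxE; apply: near_eq_derive.
by apply: (near_on openU) => // q Uq; rewrite AB.
Qed.

Lemma smooth_mx_on_partial m k (A : 'rV[R]_n -> 'M[R]_(m, k)) i :
  smooth_mx_on U A -> smooth_mx_on U (partial_mx i A).
Proof.
move=> sA a b; apply: (smooth_on_eq openU) (smooth_on_partial i (sA a b)).
by move=> p _; rewrite mxE.
Qed.

Lemma smooth_mx_on_mul m k l (A : 'rV[R]_n -> 'M[R]_(m, k))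
    (B : 'rV[R]_n -> 'M[R]_(k, l)) :
  smooth_mx_on U A -> smooth_mx_on U B -> smooth_mx_on U (fun q => A q *m B q).
Proof.
move=> sA sB a b.
have s : smooth_on U (fun q => \sum_c A q a c * B q c b).
  by apply: smooth_on_sum => // c; exact: smooth_on_mul.
by apply: (smooth_on_eq openU) s => p _; rewrite mxE.
Qed.

Lemma smooth_mx_on_add m k (A B : 'rV[R]_n -> 'M[R]_(m, k)) :
  smooth_mx_on U A -> smooth_mx_on U B -> smooth_mx_on U (fun q => A q + B q).
Proof.
move=> sA sB a b; have s := smooth_on_add openU (sA a b) (sB a b).
by apply: (smooth_on_eq openU) s => p _; rewrite mxE.
Qed.

Lemma partial_mx_add m k (A B : 'rV[R]_n -> 'M[R]_(m, k)) i p :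
  smooth_mx_on U A -> smooth_mx_on U B -> U p ->
  partial_mx i (fun q => A q + B q) p = partial_mx i A p + partial_mx i B p.
Proof.
move=> sA sB Up; apply/matrixP => a b; rewrite !mxE.
under eq_fun do rewrite mxE; apply: partialE.
by apply: is_derive_add; exact: smooth_on_is_derive Up.
Qed.

Lemma partial_mx_mul m k l (A : 'rV[R]_n -> 'M[R]_(m, k))
    (B : 'rV[R]_n -> 'M[R]_(k, l)) i p :
  smooth_mx_on U A -> smooth_mx_on U B -> U p ->
  partial_mx i (fun q => A q *m B q) p =
    partial_mx i A p *m B p + A p *m partial_mx i B p.
Proof.
move=> sA sB Up; apply/matrixP => a b; rewrite !mxE -big_split/=.
under eq_fun do rewrite mxE; apply: partialE.
apply: is_derive_sum_fun => c; rewrite !mxE.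
by apply: is_derive_mul; exact: smooth_on_is_derive Up.
Qed.

Lemma partial_mx_tr m k (A : 'rV[R]_n -> 'M[R]_(m, k)) i p :
  partial_mx i (fun q => (A q)^T) p = (partial_mx i A p)^T.
Proof. by apply/matrixP => a b; rewrite !mxE; under eq_fun do rewrite mxE. Qed.

Lemma partial_mx_comm m k (A : 'rV[R]_n -> 'M[R]_(m, k)) i j p :
  smooth_mx_on U A -> U p ->
  partial_mx i (partial_mx j A) p = partial_mx j (partial_mx i A) p.
Proof.
move=> sA Up; apply/matrixP => a b.
have E k' : (fun q => partial_mx k' A q a b) = 'd_k' (fun q => A q a b).
  by apply/funext => q; rewrite mxE.
have E2 k1 k2 : partial_mx k1 (partial_mx k2 A) p a b =
    'd_k1 ('d_k2 (fun q => A q a b)) p.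
  by rewrite -(E k2) mxE.
apply: etrans (E2 _ _) (etrans _ (esym (E2 _ _))).
exact: (smooth_on_comm openU i j (sA a b) Up).
Qed.

Lemma smooth_mx_on_cst m k (A : 'M[R]_(m, k)) : smooth_mx_on U (fun=> A).
Proof. by move=> a b; exact: smooth_on_cst. Qed.

Lemma smooth_mx_on_tr m k (A : 'rV[R]_n -> 'M[R]_(m, k)) :
  smooth_mx_on U A -> smooth_mx_on U (fun q => (A q)^T).
Proof.
move=> sA a b; apply: (smooth_on_eq openU) (sA b a) => p _; by rewrite mxE.
Qed.

End MatrixCalculus.

(** * Cartan's method: flatness from a coframe [J] and connection matrices [omega] *)

Section Coframe.
Variables (R : realType) (n : nat) (U : set 'rV[R]_n).
Variables (g J : 'rV[R]_n -> 'M[R]_n) (eta : 'M[R]_n).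
Variable omega : 'I_n -> 'rV[R]_n -> 'M[R]_n.
Hypothesis openU : open U.
Hypothesis smoothJ : smooth_mx_on U J.
Hypothesis smooth_omega : forall i, smooth_mx_on U (omega i).
Hypothesis eta_sym : eta^T = eta.
Hypothesis gE : forall p, U p -> g p = (J p)^T *m eta *m J p.
Hypothesis g_unit : forall p, U p -> g p \in unitmx.
Hypothesis omega_antisym : forall p i, U p ->
  (omega i p)^T *m eta + eta *m omega i p = 0.

(** Row [a] of [J] holds the components of the coframe form e_a, and [D i] is its covariant
    derivative along coordinate [i]. Symmetry of [D i p a j] in [i] and [j] is the first structure
    equation without torsion. *)
Let D i p := partial_mx i J p + omega i p *m J p.

Hypothesis torsion_free : forall p i j a, U p -> D i p a j = D j p a i.
Hypothesis curvature0 : forall p k l, U p ->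
  partial_mx k (omega l) p - partial_mx l (omega k) p
  + omega k p *m omega l p - omega l p *m omega k p = 0.

(** The gauge transform of [omega] to the coordinate frame, to be identified with the Christoffel
    symbols. [Lower] is [Gamma] with its upper index lowered by [g]. *)
Let Gamma i p := invmx (J p) *m D i p.
Let Lower i p := (J p)^T *m eta *m D i p.

Let J_unit p : U p -> J p \in unitmx.
Proof.
by move=> Up; have := g_unit Up; rewrite gE// unitmx_mul => /andP[].
Qed.

Let smooth_g : smooth_mx_on U g.
Proof.
have s : smooth_mx_on U (fun p => (J p)^T *m eta *m J p).
  apply: (smooth_mx_on_mul openU) smoothJ.
  exact: (smooth_mx_on_mul openU (smooth_mx_on_tr openU smoothJ) (smooth_mx_on_cst eta)).
by move=> a b; apply: (smooth_on_eq openU) (s a b) => p Up; rewrite gE.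
Qed.

Let D_Gamma i p : U p -> J p *m Gamma i p = D i p.
Proof. by move=> Up; rewrite mulKVmx ?J_unit. Qed.

Let partial_J i p : partial_mx i J p = D i p - omega i p *m J p.
Proof. by rewrite addrK. Qed.

(** Metric compatibility: in the product rule for J^T eta J, [partial_J] replaces the derivatives of
    [J], and the terms in [omega] cancel by [omega_antisym]. *)
Let partial_g i p : U p -> partial_mx i g p = Lower i p + (Lower i p)^T.
Proof.
move=> Up.
rewrite (partial_mx_eq openU (B := fun p => (J p)^T *m (eta *m J p)))//; last first.
  by move=> q Uq; rewrite gE// mulmxA.
have sE : smooth_mx_on U (fun p => eta *m J p).
  exact: (smooth_mx_on_mul openU (smooth_mx_on_cst eta) smoothJ).
rewrite (partial_mx_mul i (smooth_mx_on_tr openU smoothJ) sE Up) partial_mx_tr.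
rewrite (partial_mx_mul i (smooth_mx_on_cst eta) smoothJ Up).
have -> : partial_mx i (fun=> eta) p = 0.
  by apply/matrixP => a b; rewrite !mxE; apply: partialE; exact: is_derive_cst.
rewrite mul0mx add0r partial_J /Lower !trmx_mul trmxK eta_sym.
rewrite raddfB/= mulmxBl !mulmxBr trmx_mul -!mulmxA.
have /(congr1 (fun A => (J p)^T *m (A *m J p))) := omega_antisym i Up.
rewrite mul0mx mulmx0 mulmxDl mulmxDr -!mulmxA => /eqP.
rewrite addr_eq0 => /eqP ->.
by rewrite opprK addrACA subrr addr0 addrC.
Qed.

(** Uniqueness of the Levi-Civita connection. By [partial_g] the three derivatives of [g] give six
    terms in [Lower]; the symmetry coming from [torsion_free] cancels four of them and makes the
    other two equal. *)
Let christoffelE k i j p : U p -> christoffel g k i j p = Gamma i p k j.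
Proof.
move=> Up.
have L a b c : Lower a p c b = Lower b p c a.
  by rewrite !mxE; apply: eq_bigr => s _; rewrite torsion_free.
have dg a b c : 'd_a (fun q => g q b c) p = Lower a p b c + Lower a p c b.
  have /matrixP/(_ b c) := partial_g a Up.
  by rewrite mxE => ->; rewrite mxE [X in _ + X]mxE.
have GE : Gamma i p = invmx (g p) *m Lower i p.
  by rewrite /Lower -(D_Gamma i Up) mulmxA -gE// mulKmx ?g_unit.
rewrite GE mxE /christoffel mulr_sumr; apply: eq_bigr => m _.
rewrite !dg (L i m j) (L j m i) (L m j i) (L j i m).
set a := Lower _ _ _ _; set b := Lower _ _ _ _; set c := Lower _ _ _ _.
by field.
Qed.

Let smooth_D i : smooth_mx_on U (D i).
Proof.
apply: (smooth_mx_on_add openU); first exact: (smooth_mx_on_partial openU i smoothJ).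
exact: (smooth_mx_on_mul openU (smooth_omega i) smoothJ).
Qed.

Let smooth_Gamma i : smooth_mx_on U (Gamma i).
Proof.
apply: (smooth_mx_on_mul openU) (smooth_D i) => a b.
exact: (smooth_on_invmx openU smoothJ J_unit).
Qed.

(** Obtained by differentiating J Gamma_l = D_l and solving for the derivative of Gamma_l, which
    avoids differentiating [invmx (J p)]. *)
Let J_partial_Gamma k l p : U p -> J p *m partial_mx k (Gamma l) p =
  partial_mx k (partial_mx l J) p + partial_mx k (omega l) p *m J p
  + omega l p *m (J p *m Gamma k p - omega k p *m J p)
  - (J p *m Gamma k p - omega k p *m J p) *m Gamma l p.
Proof.
move=> Up; have dD : partial_mx k (D l) p = partial_mx k (fun q => J q *m Gamma l q) p.
  by apply: (partial_mx_eq openU k _ Up) => q Uq; rewrite D_Gamma.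
have dJ : partial_mx k J p = J p *m Gamma k p - omega k p *m J p.
  by rewrite partial_J D_Gamma.
have sdJ := smooth_mx_on_partial openU l smoothJ.
have swJ := smooth_mx_on_mul openU (smooth_omega l) smoothJ.
move: dD; rewrite (partial_mx_mul k smoothJ (smooth_Gamma l) Up) dJ.
rewrite (partial_mx_add k sdJ swJ Up).
rewrite (partial_mx_mul k (smooth_omega l) smoothJ Up) dJ addrA => ->.
by rewrite addrC addKr.
Qed.

(* Cartan's structure equations with vanishing torsion and curvature. *)
Lemma flat_of_coframe : flat_on U g.
Proof.
split=> [//||p Up i j k l].
  split; [exact: smooth_g| |exact: g_unit].
  by move=> p Up; rewrite gE// !trmx_mul trmxK eta_sym mulmxA.
rewrite /riemann big1// => m _.
(* The curvature components are the entries of the curvature matrix of [Gamma]. *)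
have -> : riemann_up g m j k l p = (partial_mx k (Gamma l) p
    - partial_mx l (Gamma k) p
    + (Gamma k p *m Gamma l p - Gamma l p *m Gamma k p)) m j.
  have dG a b : 'd_a (christoffel g m b j) p = partial_mx a (Gamma b) p m j.
    rewrite mxE; apply: near_eq_derive; apply: (near_on openU) Up => q Uq.
    exact: christoffelE.
  rewrite /riemann_up !dG !mxE -sumrB; congr (_ + _).
  by apply: eq_bigr => s _; rewrite !christoffelE.
suff -> : partial_mx k (Gamma l) p - partial_mx l (Gamma k) p
    + (Gamma k p *m Gamma l p - Gamma l p *m Gamma k p) = 0 by rewrite mxE mulr0.
(* Multiplication by the invertible [J p] turns the curvature of [Gamma] into that of [omega] times
   [J p]; the second derivatives of [J] cancel by symmetry. *)
apply: (can_inj (mulKmx (J_unit Up))); rewrite mulmx0.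
rewrite mulmxDr !mulmxBr !J_partial_Gamma//.
have /(congr1 (mulmx^~ (J p))) := curvature0 k l Up.
rewrite mul0mx (partial_mx_comm openU l k smoothJ Up).
move: (Gamma k p) (Gamma l p) => Gk Gl.
rewrite !(mulmxDl, mulmxDr, mulmxN, mulNmx) !mulmxA => <-.
move: (omega l p *m J p *m Gk) (omega k p *m J p *m Gl) => X Y.
move: (J p *m Gk *m Gl) (J p *m Gl *m Gk) (omega k p *m omega l p *m J p) => V W Z.
move: (omega l p *m omega k p *m J p) (partial_mx k _ p *m J p) => T P.
move: (partial_mx l _ p *m J p) (partial_mx k _ p) => Q S.
by apply/matrixP => a b; rewrite !mxE; ring.
Qed.

End Coframe.

(** * Case analysis and sums over six indices *)

Lemma ord6P (P : 'I_6 -> Prop) : P 0 -> P 1 -> P 2 -> P 3 -> P 4 -> P 5 ->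
  forall i, P i.
Proof.
move=> P0 P1 P2 P3 P4 P5 [[|[|[|[|[|[|//]]]]]] lti].
- by have -> : Ordinal lti = 0 by exact/val_inj.
- by have -> : Ordinal lti = 1 by exact/val_inj.
- by have -> : Ordinal lti = 2 by exact/val_inj.
- by have -> : Ordinal lti = 3 by exact/val_inj.
- by have -> : Ordinal lti = 4 by exact/val_inj.
- by have -> : Ordinal lti = 5 by exact/val_inj.
Qed.

Lemma sum_ord6 (V : nmodType) (f : 'I_6 -> V) :
  \sum_i f i = f 0 + f 1 + f 2 + f 3 + f 4 + f 5.
Proof.
rewrite !big_ord_recr big_ord0 /= add0r.
by do ![congr (_ + _)]; congr f; exact/val_inj.
Qed.

(** * Pull-back of functions of (x, z) to the six coordinates *)

Section Pullback.
Variable R : realType.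
Implicit Types (G : 'rV[R]_2 -> R) (p v : 'rV[R]_6).

Lemma xz_linear (h : R) v p : xz (h *: v + p) = h *: xz v + xz p.
Proof. by apply/rowP => k; rewrite !mxE; case: ifP. Qed.

Lemma xz_continuous : continuous (@xz R).
Proof.
move=> p A /nbhs_ballP[e e0 eA]; apply/nbhs_ballP; exists e => // q pq.
by apply: eA; split=> // i j; rewrite !mxE; case: ifP => _; exact: pq.2.
Qed.

(** Linearity of [xz] identifies the difference quotients, so a derivative of the pull-back along
    [v] is one of [G] along [xz v]. *)
Lemma quotient_xz G p v :
  (fun h : R => h^-1 *: (((fun q => G (xz q)) \o shift p) (h *: v) - G (xz p)))
    = (fun h : R => h^-1 *: ((G \o shift (xz p)) (h *: xz v) - G (xz p))).
Proof. by apply/funext => h /=; rewrite xz_linear. Qed.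

Lemma derive_xz G p v : 'D_v (fun q => G (xz q)) p = 'D_(xz v) G (xz p).
Proof. by rewrite /derive quotient_xz. Qed.

Lemma is_derive_xz G p v a : is_derive (xz p) (xz v) G a ->
  is_derive p v (fun q => G (xz q)) a.
Proof.
by case=> dG <-; split; [rewrite /derivable quotient_xz|exact: derive_xz].
Qed.

Lemma xz_delta (i : 'I_6) : xz (delta_mx 0 i) =
  (i == 0)%:R *: delta_mx 0 0 + (i == 2)%:R *: delta_mx 0 1 :> 'rV[R]_2.
Proof.
apply/rowP => k; rewrite !mxE/= ![_ == i]eq_sym.
case: k => [[|[|//]] ltk]/=; first by rewrite mulr1 mulr0 addr0.
by rewrite mulr0 mulr1 add0r.
Qed.

Lemma is_derive_xz_delta U G p i : smooth_on U G -> U (xz p) ->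
  is_derive p (delta_mx 0 i) (fun q => G (xz q))
    ('dx G (xz p) * (i == 0)%:R + 'dz G (xz p) * (i == 2)%:R).
Proof.
move=> sG Up; apply: is_derive_xz; rewrite xz_delta.
have [->|i0] := eqVneq i 0.
  rewrite scale1r scale0r addr0 mulr1 mulr0 addr0.
  exact: (smooth_on_is_derive 0 sG Up).
have [_|i2] := eqVneq i 2.
  rewrite scale0r scale1r add0r mulr0 mulr1 add0r.
  exact: (smooth_on_is_derive 1 sG Up).
by rewrite !scale0r !mulr0 !addr0; exact: is_derive0.
Qed.

(** Coinduction on the class of pull-backs: a partial derivative of a pull-back is the pull-back of
    ['dx G], of ['dz G] or of zero. *)
Lemma smooth_on_xz (U : set 'rV[R]_2) (D : set 'rV[R]_6) G :
  (forall p, D p -> U (xz p)) -> smooth_on U G ->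
  smooth_on D (fun p => G (xz p)).
Proof.
move=> DU sG.
apply: (@smooth_on_coind _ _ _ (fun h => exists2 G, smooth_on U G &
  h = (fun p => G (xz p)))); last by exists G.
move=> _ [{sG}G sG ->]; split=> [p /DU Up|i].
  split=> [|i]; last by case: (is_derive_xz_delta i sG Up).
  apply: continuous_comp; first exact: xz_continuous.
  exact: smooth_on_continuous sG Up.
have E H : (forall q, 'D_(xz (delta_mx 0 i)) G q = H q) ->
    'd_i (fun p => G (xz p)) = (fun p => H (xz p)).
  by move=> GH; apply/funext => p; rewrite -GH; exact: derive_xz.
rewrite xz_delta in E.
have [i0|i0] := eqVneq i 0.
  exists ('dx G); first exact: smooth_on_partial 0 sG.
  by apply: E => q; rewrite i0 scale1r scale0r addr0.
have [i2|i2] := eqVneq i 2.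
  exists ('dz G); first exact: smooth_on_partial 1 sG.
  by apply: E => q; rewrite i2 scale1r scale0r add0r.
exists (fun=> 0); first exact: smooth_on_cst.
by apply: (E (fun=> 0)) => q; rewrite (negPf i0) (negPf i2) !scale0r addr0 derive0.
Qed.

End Pullback.

(** * Consequences of the evolution equation for [F2] *)

Section SchwarzianKdV.
Variables (R : realType) (U : set 'rV[R]_2) (F2 : 'rV[R]_2 -> R).
Hypothesis openU : open U.
Hypothesis smoothF2 : smooth_on U F2.
Hypothesis dxF2_neq0 : forall q, U q -> 'dx F2 q != 0.
Hypothesis dzF2E : forall q, U q ->
  'dz F2 q = - 'dx ('dx ('dx F2)) q
             + 3 / 2 * ('dx ('dx F2) q ^+ 2 / 'dx F2 q).

(** The function a of the overview, the logarithmic x-derivative of ['dx F2]. *)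
Definition dlog_dx (q : 'rV[R]_2) : R := 'dx ('dx F2) q / 'dx F2 q.

Lemma smooth_dx : smooth_on U ('dx F2).
Proof. exact: smooth_on_partial. Qed.

Lemma smooth_inv_dx : smooth_on U (fun q => ('dx F2 q)^-1).
Proof. exact: (smooth_on_inv openU smooth_dx dxF2_neq0). Qed.

Lemma smooth_dlog_dx : smooth_on U dlog_dx.
Proof.
exact: (smooth_on_mul openU (smooth_on_partial 0 smooth_dx) smooth_inv_dx).
Qed.

Lemma smooth_l : smooth_on U (l F2).
Proof.
have s3 := smooth_on_partial 0 (smooth_on_partial 0 smooth_dx).
have s2 := smooth_on_opp openU (smooth_on_mul openU (smooth_on_cst 2) s3).
have s1 := smooth_on_add openU (smooth_on_partial 1 smoothF2) s2.
exact: (smooth_on_mul openU (smooth_on_cst (- (1 / 3)))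
  (smooth_on_mul openU s1 smooth_inv_dx)).
Qed.

Lemma lE q : U q -> l F2 q = 'dx ('dx ('dx F2)) q / 'dx F2 q - dlog_dx q ^+ 2 / 2.
Proof.
move=> Uq; rewrite /l dzF2E// /dlog_dx; have := dxF2_neq0 Uq.
move: ('dx F2 q) ('dx ('dx F2) q) ('dx ('dx ('dx F2)) q) => a b c a0.
by field.
Qed.

Lemma dx_dxE q : U q -> 'dx ('dx F2) q = dlog_dx q * 'dx F2 q.
Proof. by move=> Uq; rewrite /dlog_dx divfK// dxF2_neq0. Qed.

(** The factor l - a^2 is the Schwarzian derivative of [F2] in x. *)
Lemma dzE q : U q -> 'dz F2 q = - ('dx F2 q * (l F2 q - dlog_dx q ^+ 2)).
Proof.
move=> Uq; rewrite lE// dzF2E// /dlog_dx; have := dxF2_neq0 Uq.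
move: ('dx F2 q) ('dx ('dx F2) q) ('dx ('dx ('dx F2)) q) => a b c a0.
by field.
Qed.

(** The Riccati equation relating a to the potential l. *)
Lemma dx_dlog_dx q : U q -> 'dx dlog_dx q = l F2 q - dlog_dx q ^+ 2 / 2.
Proof.
move=> Uq; have p0 := dxF2_neq0 Uq.
have dp := smooth_on_is_derive 0 smooth_dx Uq.
have ddp := smooth_on_is_derive 0 (smooth_on_partial 0 smooth_dx) Uq.
apply: partialE; apply: is_derive_eq (is_derive_mul ddp (is_derive_inv p0 dp)) _.
rewrite lE// /dlog_dx; move: p0.
move: ('dx F2 q) ('dx ('dx F2) q) ('dx ('dx ('dx F2)) q) => a b c a0.
by field.
Qed.

(** Mixed derivatives commute, so this is [dzE] differentiated in x; the Riccati equation removes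
    the derivative of a, and the cubes of a cancel. The result makes s / F' closed. *)
Lemma dz_dxE q : U q ->
  'dz ('dx F2) q = - ('dx F2 q * ('dx (l F2) q - dlog_dx q * l F2 q)).
Proof.
move=> Uq; rewrite (smooth_on_comm openU 1 0 smoothF2 Uq).
have -> : 'dx ('dz F2) q =
    'dx (fun q => - ('dx F2 q * (l F2 q - dlog_dx q * dlog_dx q))) q.
  by apply: near_eq_derive; apply: (near_on openU) Uq => r; exact: dzE.
have dp := smooth_on_is_derive 0 smooth_dx Uq.
have dl := smooth_on_is_derive 0 smooth_l Uq.
have da := smooth_on_is_derive 0 smooth_dlog_dx Uq.
have D := is_derive_opp (is_derive_mul dp
  (is_derive_add dl (is_derive_opp (is_derive_mul da da)))).
apply: partialE; apply: is_derive_eq D _.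
rewrite dx_dxE// dx_dlog_dx//.
move: ('dx F2 q) (l F2 q) ('dx (l F2) q) (dlog_dx q) => a b c d.
by field.
Qed.

End SchwarzianKdV.

(** * The constant Gram matrix of the coframe and the nilpotent matrix N *)

Definition frame_form (R : realType) : 'M[R]_6 :=
  \matrix_(i, j) nth 0 (nth [::]
    [:: [:: 0; 0; 1; 0; 0; 0];
        [:: 0; 1; 0; 0; 0; 0];
        [:: 1; 0; 0; 0; 0; 0];
        [:: 0; 0; 0; 0; 1; 1];
        [:: 0; 0; 0; 1; 0; 1];
        [:: 0; 0; 0; 1; 1; 0]] i) j.

(* The last three rows are zero, by the default values of nth. *)
Definition nilp_mx (R : realType) : 'M[R]_6 :=
  \matrix_(i, j) nth 0 (nth [::]
    [:: [:: 0; 0; 0; 0; 0; 0];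
        [:: 1; 0; 0; 0; 0; 0];
        [:: 0; - 1; 0; 0; 0; 0]] i) j.

Section ConstantMatrices.
Variable R : realType.

Lemma frame_form_sym : (frame_form R)^T = frame_form R.
Proof. by apply/matrixP; do 2 apply: ord6P; rewrite !mxE. Qed.

Lemma frame_formM m (A : 'M[R]_(6, m)) a j : (frame_form R *m A) a j =
  nth 0 [:: A 2 j; A 1 j; A 0 j; A 4 j + A 5 j; A 3 j + A 5 j; A 3 j + A 4 j] a.
Proof. by move: a; apply: ord6P; rewrite !mxE sum_ord6 !mxE /=; ring. Qed.

(** N is an infinitesimal null rotation, hence in the Lie algebra of the orthogonal group of
    [frame_form]. *)
Lemma nilp_antisym :
  (nilp_mx R)^T *m frame_form R + frame_form R *m nilp_mx R = 0.
Proof.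
(* As the form is symmetric, the claim becomes antisymmetry of its product with N. *)
rewrite -[X in _ *m X + _]frame_form_sym -trmx_mul.
apply/matrixP => i j; rewrite mxE [X in X + _]mxE !frame_formM [RHS]mxE.
by move: i j; do 2 apply: ord6P; rewrite !mxE /= ?(addr0, addNr, addrN).
Qed.

Lemma nilp_mxM m (A : 'M[R]_(6, m)) a j :
  (nilp_mx R *m A) a j = nth 0 [:: 0; A 0 j; - A 1 j; 0; 0; 0] a.
Proof. by move: a; apply: ord6P; rewrite !mxE sum_ord6 !mxE /=; ring. Qed.

Lemma frame_form_mulmx (A : 'M[R]_6) i j : (A^T *m frame_form R *m A) i j =
  A 1 i * A 1 j + (A 0 i * A 2 j + A 2 i * A 0 j) + (A 3 i * A 4 j + A 4 i * A 3 j)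
  + (A 3 i * A 5 j + A 5 i * A 3 j) + (A 4 i * A 5 j + A 5 i * A 4 j).
Proof. by rewrite mxE sum_ord6 !mxE !sum_ord6 !mxE /=; ring. Qed.

End ConstantMatrices.

(** * The metric in coordinates: derivatives of Q, entries, invertibility *)

Lemma is_derive_coord_delta (R : realType) (k j : 'I_6) (p : 'rV[R]_6) :
  is_derive p (delta_mx 0 j) (fun q => q 0 k) (j == k)%:R.
Proof. by have := is_derive_coord k p (delta_mx 0 j); rewrite mxE eq_sym. Qed.

Lemma is_derive_uvw (R : realType) (j : 'I_6) (p : 'rV[R]_6) :
  is_derive p (delta_mx 0 j) (@uvw R)
    ((p 0 4 + p 0 5) * (j == 3)%:R + (p 0 3 + p 0 5) * (j == 4)%:R
     + (p 0 3 + p 0 4) * (j == 5)%:R).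
Proof.
have du := is_derive_coord_delta 3 j p.
have dv := is_derive_coord_delta 4 j p.
have dw := is_derive_coord_delta 5 j p.
have D := is_derive_add (is_derive_add (is_derive_mul du dw)
  (is_derive_mul dv dw)) (is_derive_mul du dv).
by apply: is_derive_eq D _; ring.
Qed.

Lemma smooth_on_uvw (R : realType) (D : set 'rV[R]_6) : open D ->
  smooth_on D (@uvw R).
Proof.
move=> oD; have s k := smooth_on_coord oD k.
exact: (smooth_on_add oD (smooth_on_add oD (smooth_on_mul oD (s 3) (s 5))
  (smooth_on_mul oD (s 4) (s 5))) (smooth_on_mul oD (s 3) (s 4))).
Qed.

(** With the entries as polynomials in Kronecker deltas, the comparison with the coframe is one
    rational identity rather than thirty-six cases. *)
Lemma metricE (R : realType) (F2 : 'rV[R]_2 -> R) (p : 'rV[R]_6) (i j : 'I_6) :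
  let e (k i : 'I_6) : R := (i == k)%:R in
  let sym k m : R := e k i * e m j + e m i * e k j in
  let y := p 0 1 in
  let lp := l F2 (xz p) in
  metric F2 p i j = y ^+ 2 * (e 0 i * e 0 j) + (y ^+ 2 * lp - 1 / 2) * sym 0 2
    + sym 1 2
    + (y ^+ 2 * lp ^+ 2 - 2 * y * 'dx (l F2) (xz p) + lp) * (e 2 i * e 2 j)
    + B F2 (xz p) y / uvw p ^+ 2 * (sym 3 4 + sym 3 5 + sym 4 5).
Proof.
move=> e sym y lp; rewrite mxE -/y -/lp.
move: (B F2 _ y / _) ('dx (l F2) _) => c dl; rewrite {}/sym {}/e.
by move: i j; do 2 apply: ord6P; rewrite /=; ring.
Qed.

Lemma metric_block_unit (R : realType) (y gxz gzz c : R) : y != 0 -> c != 0 ->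
  (\matrix_(i, j) nth 0 (nth [::]
    [:: [:: y ^+ 2; 0; gxz; 0; 0; 0];
        [:: 0;      0; 1;   0; 0; 0];
        [:: gxz;    1; gzz; 0; 0; 0];
        [:: 0;      0; 0;   0; c; c];
        [:: 0;      0; 0;   c; 0; c];
        [:: 0;      0; 0;   c; c; 0]] i) j : 'M[R]_6) \in unitmx.
Proof.
move=> y0 c0; set A := (X in X \in unitmx).
(* The explicit inverse, one 3 by 3 block at a time. *)
pose H : 'M[R]_6 := \matrix_(i, j) nth 0 (nth [::]
  [:: [:: y ^- 2; - (gxz / y ^+ 2); 0; 0; 0; 0];
      [:: - (gxz / y ^+ 2); gxz ^+ 2 / y ^+ 2 - gzz; 1; 0; 0; 0];
      [:: 0; 1; 0; 0; 0; 0];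
      [:: 0; 0; 0; - (c^-1 / 2); c^-1 / 2; c^-1 / 2];
      [:: 0; 0; 0; c^-1 / 2; - (c^-1 / 2); c^-1 / 2];
      [:: 0; 0; 0; c^-1 / 2; c^-1 / 2; - (c^-1 / 2)]] i) j.
have /mulmx1_unit[] // : A *m H = 1%:M.
apply/matrixP; do 2 apply: ord6P; rewrite mxE sum_ord6 !mxE /=.
all: rewrite ?(mul0r, mulr0, addr0, add0r, mul1r, mulr1).
all: try by [].
all: by field; rewrite ?y0 ?c0.
Qed.

Lemma metric_unit (R : realType) (F2 : 'rV[R]_2 -> R) (p : 'rV[R]_6) :
  p 0 1 != 0 -> B F2 (xz p) (p 0 1) != 0 -> uvw p != 0 ->
  metric F2 p \in unitmx.
Proof.
move=> y0 B0 Q0; apply: metric_block_unit => //.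
by rewrite mulf_neq0// invr_eq0 expf_neq0.
Qed.

(** * The adapted coframe and its connection form *)

Section Frame.
Variables (R : realType) (U : set 'rV[R]_2) (F2 : 'rV[R]_2 -> R).
Hypothesis openU : open U.
Hypothesis smoothF2 : smooth_on U F2.
Hypothesis dxF2_neq0 : forall q, U q -> 'dx F2 q != 0.
Hypothesis dzF2E : forall q, U q ->
  'dz F2 q = - 'dx ('dx ('dx F2)) q
             + 3 / 2 * ('dx ('dx F2) q ^+ 2 / 'dx F2 q).

Notation D := (metric_domain U F2).

(** The function f of the overview. *)
Definition sqrtB (p : 'rV[R]_6) : R :=
  F2 (xz p) * 2^-1 - 'dx F2 (xz p) * p 0 1.

Lemma sqrtBE p : B F2 (xz p) (p 0 1) = sqrtB p ^+ 2.
Proof.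
rewrite /B /F1 /sqrtB; move: (F2 _) ('dx F2 _) (p 0 1) => a b c.
by field.
Qed.

(** Stated for any open [V] over [U], since it serves to prove that the metric domain itself is
    open. *)
Lemma smooth_on_sqrtB V : open V -> (forall p, V p -> U (xz p)) ->
  smooth_on V sqrtB.
Proof.
move=> oV VU; have sG G := @smooth_on_xz R U V G VU.
exact: (smooth_on_add oV
  (smooth_on_mul oV (sG _ smoothF2) (smooth_on_cst 2^-1))
  (smooth_on_opp oV (smooth_on_mul oV (sG _ (smooth_dx smoothF2))
    (smooth_on_coord oV 1)))).
Qed.

(** On the open preimage of [U], nonvanishing of the continuous functions y, f and Q is an open
    condition, and B = f^2 vanishes exactly where f does. *)
Lemma open_metric_domain : open D.
Proof.
pose V := @xz R @^-1` U.
have oV : open V by apply: open_comp => // q _; exact: xz_continuous.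
have near_neq0 (f : 'rV[R]_6 -> R) p : smooth_on V f -> V p -> f p != 0 ->
    \forall q \near p, f q != 0.
  by move=> sf Vp fp; exact: (cvgr_neq0 _ (smooth_on_continuous sf Vp) fp).
rewrite openE => p [Vp y0 B0 Q0]; rewrite /interior.
have nV : \forall q \near p, V q by exact: open_nbhs_nbhs.
have ny := near_neq0 _ _ (smooth_on_coord oV 1) Vp y0.
have nQ := near_neq0 _ _ (smooth_on_uvw oV) Vp Q0.
have nf : \forall q \near p, sqrtB q != 0.
  apply: (near_neq0 _ _ (smooth_on_sqrtB oV (fun q Vq => Vq)) Vp).
  by move: B0; rewrite sqrtBE sqrf_eq0.
apply: filterS (filterI (filterI nV ny) (filterI nQ nf)) => q [[Vq yq] [Qq fq]].
by split => //; rewrite sqrtBE sqrf_eq0.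
Qed.

Lemma D_xz p : D p -> U (xz p). Proof. by case. Qed.

Lemma D_dx p : D p -> 'dx F2 (xz p) != 0.
Proof. by move/D_xz/dxF2_neq0. Qed.

Let openD := open_metric_domain.

Let s_xz G (sG : smooth_on U G) := smooth_on_xz D_xz sG.

Let s_l : smooth_on D (fun p => l F2 (xz p)) :=
  s_xz (smooth_l openU smoothF2 dxF2_neq0).

Let s_a : smooth_on D (fun p => dlog_dx F2 (xz p)) :=
  s_xz (smooth_dlog_dx openU smoothF2 dxF2_neq0).

Let s_inv : smooth_on D (fun p => ('dx F2 (xz p))^-1) :=
  s_xz (smooth_inv_dx openU smoothF2 dxF2_neq0).

Lemma smooth_sqrtB : smooth_on D sqrtB.
Proof. exact: (smooth_on_sqrtB openD D_xz). Qed.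

Let s_Q : smooth_on D (fun p => (uvw p)^-1).
Proof.
by apply: (smooth_on_inv openD (smooth_on_uvw openD)) => p [].
Qed.

(** For [k] equal to 3, 4, 5 these are the components of f X, with X the inverted point. *)
Definition inverted (k : 'I_6) (p : 'rV[R]_6) : R := sqrtB p * p 0 k * (uvw p)^-1.

Lemma smooth_inverted k : smooth_on D (inverted k).
Proof.
exact: (smooth_on_mul openD
  (smooth_on_mul openD smooth_sqrtB (smooth_on_coord openD k)) s_Q).
Qed.

(** The function f / Q. Since X1 X2 + X1 X3 + X2 X3 = 1 / Q, the form 2 (e3 e4 + e3 e5 + e4 e5)
    exceeds f^2 h by 2 df d(f / Q); the term - d(f / Q) in e2 compensates this. *)
Definition sqrtB_uvw (p : 'rV[R]_6) : R := sqrtB p * (uvw p)^-1.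

Lemma smooth_sqrtB_uvw : smooth_on D sqrtB_uvw.
Proof. exact: (smooth_on_mul openD smooth_sqrtB s_Q). Qed.

(** Component [i] of - s / F'; the Kronecker deltas are the components of dx and dz. *)
Definition theta (i : 'I_6) (p : 'rV[R]_6) : R :=
  - (((i == 0)%:R + l F2 (xz p) * (i == 2)%:R) * ('dx F2 (xz p))^-1).

Definition coframe1 (j : 'I_6) (p : 'rV[R]_6) : R :=
  p 0 1 * ((j == 0)%:R + l F2 (xz p) * (j == 2)%:R)
  - dlog_dx F2 (xz p) * (j == 2)%:R.

Definition coframe2 (j : 'I_6) (p : 'rV[R]_6) : R :=
  - (('dx F2 (xz p))^-1 * (j == 2)%:R) - 'd_j sqrtB_uvw p.

(** The exact forms e0, e3, e4, e5 are entered as gradients, so that their closedness is symmetry of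
    second derivatives. *)
Definition coframe (p : 'rV[R]_6) : 'M[R]_6 :=
  \matrix_(a, j) nth 0 [:: 'd_j sqrtB p; coframe1 j p; coframe2 j p;
    'd_j (inverted 3) p; 'd_j (inverted 4) p; 'd_j (inverted 5) p] a.

Lemma smooth_theta i : smooth_on D (theta i).
Proof.
have c k : smooth_on D (fun=> (i == k)%:R : R) by exact: smooth_on_cst.
exact: (smooth_on_opp openD (smooth_on_mul openD
  (smooth_on_add openD (c 0) (smooth_on_mul openD s_l (c 2))) s_inv)).
Qed.

Lemma smooth_coframe : smooth_mx_on D coframe.
Proof.
have c (j k : 'I_6) : smooth_on D (fun=> (j == k)%:R : R) by exact: smooth_on_cst.
move=> a j; move: a; apply: ord6P.
- apply: (smooth_on_eq openD) (smooth_on_partial j smooth_sqrtB) => p _.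
  by rewrite mxE.
- have s := smooth_on_add openD (smooth_on_mul openD (smooth_on_coord openD 1)
    (smooth_on_add openD (c j 0) (smooth_on_mul openD s_l (c j 2))))
    (smooth_on_opp openD (smooth_on_mul openD s_a (c j 2))).
  by apply: (smooth_on_eq openD) s => p _; rewrite mxE.
- have s := smooth_on_add openD (smooth_on_opp openD (smooth_on_mul openD s_inv (c j 2)))
    (smooth_on_opp openD (smooth_on_partial j smooth_sqrtB_uvw)).
  by apply: (smooth_on_eq openD) s => p _; rewrite mxE.
- apply: (smooth_on_eq openD) (smooth_on_partial j (smooth_inverted 3)) => p _.
  by rewrite mxE.
- apply: (smooth_on_eq openD) (smooth_on_partial j (smooth_inverted 4)) => p _.
  by rewrite mxE.
- apply: (smooth_on_eq openD) (smooth_on_partial j (smooth_inverted 5)) => p _.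
  by rewrite mxE.
Qed.

(** * Structure equations and the metric identity at a point *)

Section AtPoint.
Variable p : 'rV[R]_6.
Hypothesis Dp : D p.
Let Up : U (xz p) := D_xz Dp.
Let P := 'dx F2 (xz p).
Let P0 : P != 0 := D_dx Dp.
Let a := dlog_dx F2 (xz p).
Let lp := l F2 (xz p).
Let lx := 'dx (l F2) (xz p).

Lemma is_derive_F2_xz i : is_derive p (delta_mx 0 i) (fun q => F2 (xz q))
  (P * (i == 0)%:R - P * (lp - a ^+ 2) * (i == 2)%:R).
Proof.
apply: is_derive_eq (is_derive_xz_delta i smoothF2 Up) _.
by rewrite (dzE dxF2_neq0 dzF2E Up) mulNr.
Qed.

Lemma is_derive_dx_xz i : is_derive p (delta_mx 0 i) (fun q => 'dx F2 (xz q))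
  (a * P * (i == 0)%:R - P * (lx - a * lp) * (i == 2)%:R).
Proof.
apply: is_derive_eq (is_derive_xz_delta i (smooth_dx smoothF2) Up) _.
rewrite (dz_dxE openU smoothF2 dxF2_neq0 dzF2E Up) mulNr.
by rewrite (dx_dxE dxF2_neq0 Up).
Qed.

(** The decomposition of df along s, dy and dz. *)
Lemma partial_sqrtB i : 'd_i sqrtB p =
  P * ((2^-1 - p 0 1 * a) * ((i == 0)%:R + lp * (i == 2)%:R) - (i == 1)%:R
       + (p 0 1 * lx - lp + a ^+ 2 / 2) * (i == 2)%:R).
Proof.
have DD := is_derive_add
  (is_derive_mul (is_derive_F2_xz i) (is_derive_cst (2^-1 : R) p (delta_mx 0 i)))
  (is_derive_opp (is_derive_mul (is_derive_dx_xz i) (is_derive_coord_delta 1 i p))).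
apply: partialE; apply: is_derive_eq DD _; rewrite /cst -/P.
move: P a lp lx (p 0 1) => P' a' l' lx' y.
by move: (i == 0)%:R (i == 1)%:R (i == 2)%:R => s t z; field.
Qed.

(** The structure equation d e1 + theta /\ e0 = 0. The z-derivatives of l and a occur only with a
    factor symmetric in [i] and [j], so they drop out. *)
Lemma torsion1 i j : 'd_i (coframe1 j) p + theta i p * 'd_j sqrtB p =
  'd_j (coframe1 i) p + theta j p * 'd_i sqrtB p.
Proof.
have E i' j' : 'd_i' (coframe1 j') p =
    (i' == 1)%:R * ((j' == 0)%:R + lp * (j' == 2)%:R)
    + p 0 1 * ((lx * (i' == 0)%:R + 'dz (l F2) (xz p) * (i' == 2)%:R) * (j' == 2)%:R)
    - ((lp - a ^+ 2 / 2) * (i' == 0)%:R + 'dz (dlog_dx F2) (xz p) * (i' == 2)%:R)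
      * (j' == 2)%:R.
  have dl := is_derive_xz_delta i' (smooth_l openU smoothF2 dxF2_neq0) Up.
  have da := is_derive_xz_delta i' (smooth_dlog_dx openU smoothF2 dxF2_neq0) Up.
  have dy := is_derive_coord_delta 1 i' p.
  have dc (c : R) := is_derive_cst c p (delta_mx 0 i').
  have DD := is_derive_add
    (is_derive_mul dy (is_derive_add (dc _) (is_derive_mul dl (dc _))))
    (is_derive_opp (is_derive_mul da (dc _))).
  apply: partialE; apply: is_derive_eq (DD (j' == 0)%:R (j' == 2)%:R (j' == 2)%:R) _.
  rewrite (dx_dlog_dx smoothF2 dxF2_neq0 dzF2E Up) -/lp -/lx -/a.
  by rewrite /cst !mulr0 !addr0 !add0r.
rewrite !E !partial_sqrtB /theta -/P -/lp.
move: ('dz (l F2) _) ('dz (dlog_dx F2) _) => lz az.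
move: P0; move: P a lp lx (p 0 1) => P' a' l' lx' y P'0.
move: (i == 0)%:R (i == 1)%:R (i == 2)%:R => s t z.
move: (j == 0)%:R (j == 1)%:R (j == 2)%:R => s' t' z'.
by field.
Qed.

(** The structure equation d e2 - theta /\ e1 = 0. The exact part of e2 drops out, and s /\ s = 0
    leaves a dx /\ dz / F' on both sides. *)
Lemma torsion2 i j : 'd_i (coframe2 j) p - theta i p * coframe1 j p =
  'd_j (coframe2 i) p - theta j p * coframe1 i p.
Proof.
have E i' j' : 'd_i' (coframe2 j') p =
    (a * (i' == 0)%:R - (lx - a * lp) * (i' == 2)%:R) / P * (j' == 2)%:R
    - 'd_i' ('d_j' sqrtB_uvw) p.
  have dP := is_derive_inv (f := fun q => 'dx F2 (xz q)) P0 (is_derive_dx_xz i').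
  have dc (c : R) := is_derive_cst c p (delta_mx 0 i').
  have dQ := smooth_on_is_derive i' (smooth_on_partial j' smooth_sqrtB_uvw) Dp.
  have DD := is_derive_add (is_derive_opp (is_derive_mul dP (dc (j' == 2)%:R)))
    (is_derive_opp dQ).
  apply: partialE; apply: is_derive_eq DD _; rewrite /cst -/P.
  move: ('d_i' _ _) => X; move: P0; move: P a lp lx => P' a' l' lx' P'0.
  by move: (i' == 0)%:R (i' == 2)%:R (j' == 2)%:R => s z z'; field.
rewrite !E (smooth_on_comm openD j i smooth_sqrtB_uvw Dp).
move: ('d_i _ _) => X; rewrite /theta /coframe1 -/P -/lp -/a.
move: P0; move: P a lp lx (p 0 1) => P' a' l' lx' y P'0.
move: (i == 0)%:R (i == 2)%:R (j == 0)%:R (j == 2)%:R => s z s' z'.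
by field.
Qed.

(** Amounts to equality of the x-derivative of l / F' and the z-derivative of 1 / F', which is
    [dz_dxE]. *)
Lemma theta_closed i j : 'd_i (theta j) p = 'd_j (theta i) p.
Proof.
have E i' j' : 'd_i' (theta j') p =
    - ((lx * (i' == 0)%:R + 'dz (l F2) (xz p) * (i' == 2)%:R) * (j' == 2)%:R / P)
    + ((j' == 0)%:R + lp * (j' == 2)%:R)
      * (a * (i' == 0)%:R - (lx - a * lp) * (i' == 2)%:R) / P.
  have dl := is_derive_xz_delta i' (smooth_l openU smoothF2 dxF2_neq0) Up.
  have dP := is_derive_inv (f := fun q => 'dx F2 (xz q)) P0 (is_derive_dx_xz i').
  have dc (c : R) := is_derive_cst c p (delta_mx 0 i').
  have DD := is_derive_opp (is_derive_mul (is_derive_add (dc (j' == 0)%:R)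
    (is_derive_mul dl (dc (j' == 2)%:R))) dP).
  apply: partialE; apply: is_derive_eq DD _; rewrite /cst -/P -/lx -/lp.
  move: ('dz _ _) => lz; move: P0; move: P a lp lx => P' a' l' lx' P'0.
  by move: (i' == 0)%:R (i' == 2)%:R (j' == 0)%:R (j' == 2)%:R => s z s' z'; field.
rewrite !E; move: ('dz _ _) => lz; move: P0; move: P a lp lx => P' a' l' lx' P'0.
by move: (i == 0)%:R (i == 2)%:R (j == 0)%:R (j == 2)%:R => s z s' z'; field.
Qed.

Lemma partial_sqrtB_uvw i : let dQ := (p 0 4 + p 0 5) * (i == 3)%:R
    + (p 0 3 + p 0 5) * (i == 4)%:R + (p 0 3 + p 0 4) * (i == 5)%:R in
  'd_i sqrtB_uvw p = 'd_i sqrtB p / uvw p - sqrtB p * dQ / uvw p ^+ 2.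
Proof.
move=> dQ; have Q0 : uvw p != 0 by case: Dp.
have DD := is_derive_mul (smooth_on_is_derive i smooth_sqrtB Dp)
  (is_derive_inv Q0 (is_derive_uvw i p)).
by apply: partialE; apply: is_derive_eq DD _; rewrite mulNr mulrN mulrA.
Qed.

Lemma partial_inverted k i : let dQ := (p 0 4 + p 0 5) * (i == 3)%:R
    + (p 0 3 + p 0 5) * (i == 4)%:R + (p 0 3 + p 0 4) * (i == 5)%:R in
  'd_i (inverted k) p = ('d_i sqrtB p * p 0 k + sqrtB p * (i == k)%:R) / uvw p
    - sqrtB p * p 0 k * dQ / uvw p ^+ 2.
Proof.
move=> dQ; have Q0 : uvw p != 0 by case: Dp.
have DD := is_derive_mul (is_derive_mul (smooth_on_is_derive i smooth_sqrtB Dp)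
  (is_derive_coord_delta k i p)) (is_derive_inv Q0 (is_derive_uvw i p)).
by apply: partialE; apply: is_derive_eq DD _; rewrite mulNr mulrN mulrA.
Qed.

Lemma metric_coframe : metric F2 p = (coframe p)^T *m frame_form R *m coframe p.
Proof.
have Q0 : uvw p != 0 by case: Dp.
apply/matrixP => i j; rewrite metricE sqrtBE frame_form_mulmx !mxE /=.
rewrite /coframe2 !partial_sqrtB_uvw !partial_inverted.
(* The three-dimensional part: g3 = e1^2 - 2 df dz / F'. *)
have base : forall i j : 'I_6, p 0 1 ^+ 2 * ((i == 0)%:R * (j == 0)%:R)
    + (p 0 1 ^+ 2 * lp - 1 / 2)
      * ((i == 0)%:R * (j == 2)%:R + (i == 2)%:R * (j == 0)%:R)
    + ((i == 1)%:R * (j == 2)%:R + (i == 2)%:R * (j == 1)%:R)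
    + (p 0 1 ^+ 2 * lp ^+ 2 - 2 * p 0 1 * lx + lp) * ((i == 2)%:R * (j == 2)%:R)
    = coframe1 i p * coframe1 j p
      - ('d_i sqrtB p * (j == 2)%:R + (i == 2)%:R * 'd_j sqrtB p) / P.
  move=> i' j'; rewrite !partial_sqrtB /coframe1 -/lp -/a.
  move: P0; move: P a lp lx (p 0 1) => P' a' l' lx' y P'0.
  move: (i' == 0)%:R (i' == 1)%:R (i' == 2)%:R => s t z.
  move: (j' == 0)%:R (j' == 1)%:R (j' == 2)%:R => s' t' z'.
  by field.
have {}base := base i j; rewrite -/lp -/lx -/P.
apply: etrans (congr1 (+%R^~ _) base) _.
(* What remains is f^2 h = 2 (e3 e4 + e3 e5 + e4 e5) - 2 df d(f / Q), an identity in which f and the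
   components of df are free variables. *)
move: P0 Q0; rewrite /uvw; move: ('d_i sqrtB p) ('d_j sqrtB p) (sqrtB p) => fi fj f.
move: (coframe1 i p) (coframe1 j p) P (p 0 3) (p 0 4) (p 0 5) => ei ej P' u v w.
move: (i == 2)%:R (i == 3)%:R (i == 4)%:R (i == 5)%:R => z ui vi wi.
move: (j == 2)%:R (j == 3)%:R (j == 4)%:R (j == 5)%:R => z' uj vj wj P'0 Q0.
by field; rewrite P'0 Q0.
Qed.

(** N has zero rows 0, 3, 4, 5, where the forms are exact; rows 1 and 2 are the two structure
    equations above. *)
Lemma coframe_torsion i j b :
  (partial_mx i coframe p + (theta i p *: nilp_mx R) *m coframe p) b j =
  (partial_mx j coframe p + (theta j p *: nilp_mx R) *m coframe p) b i.
Proof.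
have E i' j' b' :
    (partial_mx i' coframe p + (theta i' p *: nilp_mx R) *m coframe p) b' j' =
    'd_i' (fun q => coframe q b' j') p + theta i' p *
      nth 0 [:: 0; 'd_j' sqrtB p; - coframe1 j' p; 0; 0; 0] b'.
  by rewrite -scalemxAl mxE [X in X + _]mxE [X in _ + X]mxE nilp_mxM !mxE.
have row b' j' f : (forall q, coframe q b' j' = f q) -> (fun q => coframe q b' j') = f.
  by move=> fE; apply/funext.
rewrite !E; move: b; apply: ord6P => /=.
- rewrite !mulr0 !addr0.
  rewrite (row 0 j ('d_j sqrtB)) => [|q]; last by rewrite mxE.
  rewrite (row 0 i ('d_i sqrtB)) => [|q]; last by rewrite mxE.
  exact: (smooth_on_comm openD i j smooth_sqrtB Dp).
- rewrite (row 1 j (coframe1 j)) => [|q]; last by rewrite mxE.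
  rewrite (row 1 i (coframe1 i)) => [|q]; last by rewrite mxE.
  exact: torsion1.
- rewrite (row 2 j (coframe2 j)) => [|q]; last by rewrite mxE.
  rewrite (row 2 i (coframe2 i)) => [|q]; last by rewrite mxE.
  by rewrite !mulrN; exact: torsion2.
- rewrite !mulr0 !addr0.
  rewrite (row 3 j ('d_j (inverted 3))) => [|q]; last by rewrite mxE.
  rewrite (row 3 i ('d_i (inverted 3))) => [|q]; last by rewrite mxE.
  exact: (smooth_on_comm openD i j (smooth_inverted 3) Dp).
- rewrite !mulr0 !addr0.
  rewrite (row 4 j ('d_j (inverted 4))) => [|q]; last by rewrite mxE.
  rewrite (row 4 i ('d_i (inverted 4))) => [|q]; last by rewrite mxE.
  exact: (smooth_on_comm openD i j (smooth_inverted 4) Dp).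
- rewrite !mulr0 !addr0.
  rewrite (row 5 j ('d_j (inverted 5))) => [|q]; last by rewrite mxE.
  rewrite (row 5 i ('d_i (inverted 5))) => [|q]; last by rewrite mxE.
  exact: (smooth_on_comm openD i j (smooth_inverted 5) Dp).
Qed.

Lemma partial_theta_nilp i j :
  partial_mx i (fun q => theta j q *: nilp_mx R) p = 'd_i (theta j) p *: nilp_mx R.
Proof.
apply/matrixP => b c; rewrite !mxE.
have -> : (fun q => (theta j q *: nilp_mx R) b c) =
    (fun q => theta j q * nilp_mx R b c).
  by apply/funext => q; rewrite mxE.
have DD := is_derive_mul (smooth_on_is_derive i (smooth_theta j) Dp)
  (is_derive_cst (nilp_mx R b c) p (delta_mx 0 i)).
by apply: partialE; apply: is_derive_eq DD _; rewrite mulr0 addr0 /cst mxE.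
Qed.

End AtPoint.

Lemma metric_flat : flat_on D (metric F2).
Proof.
apply: (@flat_of_coframe R 6 D (metric F2) coframe (frame_form R)
  (fun i p => theta i p *: nilp_mx R) openD smooth_coframe).
- move=> i b c.
  have s := smooth_on_mul openD (smooth_theta i) (smooth_on_cst (nilp_mx R b c)).
  by apply: (smooth_on_eq openD) s => p _; rewrite [RHS]mxE.
- exact: frame_form_sym.
- exact: metric_coframe.
- by move=> p [Up y0 B0 Q0]; exact: metric_unit.
- move=> p i _; rewrite [_^T]linearZ/= -scalemxAl -scalemxAr -scalerDr.
  by rewrite nilp_antisym scaler0.
- by move=> p i j b Dp; exact: coframe_torsion.
(* Closedness of theta removes the derivative terms; the connection matrices are multiples of the
   single matrix N, so they commute. *)
- move=> p i j Dp; rewrite !partial_theta_nilp// (theta_closed Dp) subrr add0r.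
  by rewrite -!scalemxAl -!scalemxAr !scalerA [theta j p * _]mulrC subrr.
Qed.

End Frame.

Theorem theorem1 (R : realType) (U : set 'rV[R]_2) (F2 : 'rV[R]_2 -> R)
    (openU : open U) (smoothF2 : smooth_on U F2)
    (dxF2_neq0 : forall q, U q -> 'dx F2 q != 0)
    (dzF2E : forall q, U q ->
      'dz F2 q = - 'dx ('dx ('dx F2)) q
                 + 3 / 2 * ('dx ('dx F2) q ^+ 2 / 'dx F2 q)) :
  flat_on (metric_domain U F2) (metric F2).
Proof. exact: metric_flat. Qed.
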